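(* There is an absolute constant $c>0$ such that the following holds. Let $L\ge2$, $2L+1\le N$, $\lambda>0$, $\beta_{0,1}=0$. Let $f,f^\epsilon\in C(\mathbb{S}^1)$, where $f^\epsilon$ is a noisy version of $f$ with $\|f-f^\epsilon\|_\infty=\|\epsilon\|_\infty$. Let $n=\lfloor L/2\rfloor$ and assume $L$ is large enough that $\|V_nf-f\|_\infty\le\|\epsilon\|_\infty$. Then $$\|\mathcal U^\beta_{\lambda,L,N}f^\epsilon-f\|_\infty\le c\,\|\epsilon\|_\infty\,\|\mathcal U^\beta_{\lambda,L,N}\|_\infty+\sqrt{\lambda L}\,\|f\|_{W^{\phi,\beta}}.$$
   Context: Points $x=(\cos\theta,\sin\theta)^T$ of the unit circle $\mathbb{S}^1$ are identified with angles $\theta\in[-\pi,\pi]$ (mod $2\pi$). $C(\mathbb{S}^1)$ is the space of real continuous functions on $\mathbb{S}^1$, $\|g\|_\infty=\max_{\mathbb{S}^1}|g|$, $\langle f,g\rangle_{L_2}=\int_{-\pi}^{\pi}fg\,dx$. Put $Y_{0,1}=1/\sqrt{2\pi}$, $Y_{\ell,1}(x)=\cos(\ell\theta)/\sqrt\pi$, $Y_{\ell,2}(x)=\sin(\ell\theta)/\sqrt\pi$ for $\ell\ge1$; $\gamma_0=0$ and $\gamma_\ell=1$ for $\ell\ge1$. The points $x_1,\dots,x_N\in\mathbb{S}^1$ are equidistant with angular step $2\pi/N$ (trapezoidal rule nodes), and $\langle v,z\rangle_N=\frac{2\pi}{N}\sum_{j=1}^Nv(x_j)z(x_j)$. $\beta_{0,1},\beta_{1,1},\beta_{1,2},\beta_{2,1},\beta_{2,2},\dots$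 is a nondecreasing sequence of nonnegative reals. The operator is $$\mathcal U^\beta_{\lambda,L,N}g(x)=\sum_{\ell=0}^L\sum_{k=1}^{\gamma_\ell+1}\frac{\langle g,Y_{\ell,k}\rangle_N}{1+\lambda\beta_{\ell,k}^2}Y_{\ell,k}(x),$$ and its Lebesgue constant is $\|\mathcal U^\beta_{\lambda,L,N}\|_\infty=\sup_{0\ne g\in C(\mathbb{S}^1)}\|\mathcal U^\beta_{\lambda,L,N}g\|_\infty/\|g\|_\infty$. With smoothness index function $\phi(t)=t^{1/2}$, the norm is $$\|f\|_{W^{\phi,\beta}}=\Big(\sum_{\ell=0}^\infty\sum_{k=1}^{\gamma_\ell+1}\frac{|\langle f,Y_{\ell,k}\rangle_{L_2}|^2}{\phi^2(\beta_{\ell,k}^{-2})}\Big)^{1/2}=\Big(\sum_{\ell=0}^\infty\sum_{k=1}^{\gamma_\ell+1}\beta_{\ell,k}^2|\langle f,Y_{\ell,k}\rangle_{L_2}|^2\Big)^{1/2}$$ (assumed finite, i.e. $f\in W^{\phi,\beta}$). The de la Vallée-Poussin approximation is $$V_nf(x)=\sum_{\ell=0}^{2n-1}\sum_{k=1}^{\gamma_\ell+1}h(\ell,k)\langle f,Y_{\ell,k}\rangle_{L_2}Y_{\ell,k}(x),\qquad h(\ell,k)=\begin{cases}1,&\ell\le n,\\ 1-\frac{\ell-n}{n},&n+1\le\ell\le2n-1.\end{cases}$$ *)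

(* Defs.v *)
From HB Require Import structures.
From mathcomp Require Import all_boot all_order all_algebra.
From mathcomp Require Import all_classical all_reals all_analysis.
Set Implicit Arguments.
Unset Strict Implicit.
Unset Printing Implicit Defensive.
Import Order.TTheory GRing.Theory Num.Theory.
Import numFieldNormedType.Exports.
Local Open Scope classical_set_scope.
Local Open Scope ring_scope.

(* A function on the unit circle is represented by the 2 pi-periodic function
   of the angle it induces on R. *)
Definition CS1 (R : realType) (g : R -> R) : Prop :=
  continuous g /\ periodic g (pi *+ 2).

(* On CS1 this supremum is a maximum, by compactness of the circle. *)
Definition supnorm (R : realType) (g : R -> R) : R :=
  sup [set `|g t| | t in [set: R]].

Definition innerL2 (R : realType) (f g : R -> R) : R :=
  Rintegral (@lebesgue_measure R) `[- pi, pi] (fun t => f t * g t).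

Definition gam (l : nat) : nat := if l is 0%N then 0%N else 1%N.

Definition Y (R : realType) (l k : nat) (t : R) : R :=
  if l == 0%N then (Num.sqrt (pi *+ 2))^-1
  else if k == 1%N then cos (l%:R * t) / Num.sqrt pi
  else sin (l%:R * t) / Num.sqrt pi.

(* The nodes are the points of angles x 1, ..., x N; since angles are only
   meaningful mod 2 pi, so is the step between consecutive nodes. *)
Definition equidistant (R : realType) (N : nat) (x : nat -> R) : Prop :=
  forall j, (1 <= j < N)%N ->
    exists m : int, x j.+1 = x j + pi *+ 2 / N%:R + (pi *+ 2) *~ m.

Definition innerN (R : realType) (N : nat) (x : nat -> R) (v z : R -> R) : R :=
  pi *+ 2 / N%:R * \sum_(1 <= j < N.+1) v (x j) * z (x j).

(* Only the values beta l k with 1 <= k <= gam l + 1 are used; they are listed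
   in the lexicographic order of (l, k). *)
Definition admissible_beta (R : realType) (beta : nat -> nat -> R) : Prop :=
  (forall l k, (1 <= k <= (gam l).+1)%N -> 0 <= beta l k) /\
  (forall l k l' k', (1 <= k <= (gam l).+1)%N -> (1 <= k' <= (gam l').+1)%N ->
     (l < l')%N || (l == l') && (k <= k')%N -> beta l k <= beta l' k').

Definition Uop (R : realType) (beta : nat -> nat -> R) (lambda : R) (L N : nat)
    (x : nat -> R) (g : R -> R) (t : R) : R :=
  \sum_(0 <= l < L.+1) \sum_(1 <= k < (gam l).+2)
    innerN N x g (@Y R l k) / (1 + lambda * beta l k ^+ 2) * Y l k t.

(* The set of quotients is bounded since Uop has finite rank, so that the real
   supremum is the genuine one. *)
Definition lebesgue_constant (R : realType) (T : (R -> R) -> R -> R) : R :=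
  sup [set supnorm (T g) / supnorm g | g in [set g | CS1 g /\ g <> cst 0]].

Definition phi_half (R : realType) (t : R) : R := t `^ 2^-1.

(* If beta l k = 0, then beta l k ^- 2 = 0, and if moreover phi 0 = 0, as is
   the case for phi_half, the coefficient gets the weight 0^-1 = 0. *)
Definition Wterm (R : realType) (phi : R -> R) (beta : nat -> nat -> R)
    (f : R -> R) (l : nat) : R :=
  \sum_(1 <= k < (gam l).+2)
    `|innerL2 f (@Y R l k)| ^+ 2 / phi (beta l k ^- 2) ^+ 2.

Definition inW (R : realType) (phi : R -> R) (beta : nat -> nat -> R)
    (f : R -> R) : Prop :=
  cvgn (series (Wterm phi beta f)).

Definition Wnorm (R : realType) (phi : R -> R) (beta : nat -> nat -> R)
    (f : R -> R) : R :=
  Num.sqrt (limn (series (Wterm phi beta f))).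

Lemma Wterm_phi_half (R : realType) (beta : nat -> nat -> R) (f : R -> R) l :
  Wterm (@phi_half R) beta f l =
  \sum_(1 <= k < (gam l).+2) beta l k ^+ 2 * `|innerL2 f (@Y R l k)| ^+ 2.
Proof.
apply: eq_bigr => k _; rewrite /phi_half.
have h : 0 <= beta l k ^- 2 by rewrite invr_ge0 sqr_ge0.
by rewrite powR12_sqrt // sqr_sqrtr // invrK mulrC.
Qed.

Definition hVP (R : realType) (n l : nat) : R :=
  if (l <= n)%N then 1 else 1 - (l%:R - n%:R) / n%:R.

Definition VP (R : realType) (n : nat) (f : R -> R) (t : R) : R :=
  \sum_(0 <= l < n.*2) \sum_(1 <= k < (gam l).+2)
    hVP R n l * innerL2 f (@Y R l k) * Y l k t.

(* Main.v *)
Require Import Defs.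
From HB Require Import structures.
From mathcomp Require Import all_boot all_order all_algebra.
From mathcomp Require Import all_classical all_reals all_analysis.
From mathcomp Require Import ring lra.
Set Implicit Arguments.
Unset Strict Implicit.
Unset Printing Implicit Defensive.
Import Order.TTheory GRing.Theory Num.Theory.
Import numFieldNormedType.Exports.
Local Open Scope classical_set_scope.
Local Open Scope ring_scope.

(** Write U for the operator, p for the de la Vallee-Poussin mean V_n f,
    Lam for the Lebesgue constant of U, and decompose

      U feps - f = U (feps - f) + U (f - p) + (U p - p) + (p - f).

    The first two terms are at most Lam * |eps| each, the second one because
    |f - p| <= |eps|.  The last one is at most |eps|, and |eps| <= Lam * |eps|
    because Lam >= 1: as beta_{0,1} = 0, the operator fixes the constants
    (lebesgue_Uop_ge1).  This accounts for c = 3.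

    The remaining term U p - p is the bias of the filter.  It is computable
    because 2 L < N makes the trapezoidal rule exact on products of two
    trigonometric polynomials of degree at most L, so that the Y_{l,k} are
    orthonormal for the discrete inner product (innerN_YY) and are therefore
    eigenfunctions of U (Uop_Y).  Since p has degree at most 2 n - 1 < L, each of
    its coefficients h c_{l,k}, with c_{l,k} the L2 coefficient of f and
    0 <= h <= 1, is multiplied in p - U p by
    1 - 1 / (1 + a^2) <= a, where a = sqrt lambda * beta_{l,k}
    (filter_bias_le).  Cauchy-Schwarz separates sqrt lambda * beta |c|, whose
    square sum is at most lambda * |f|_W^2, from |Y_{l,k} t|, whose square sum
    is less than L by the addition identity cos^2 + sin^2 = 1 (sum_Y_sqr).  The
    product of the two square roots is sqrt (lambda L) * |f|_W. *)

(** * Continuous functions on the circle and their supremum norm *)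

Lemma periodicz (U V : zmodType) (f : U -> V) (T : U) :
  periodic f T -> forall (m : int) u, f (u + T *~ m) = f u.
Proof.
move=> fT [] n u; first exact: periodicn.
by rewrite NegzE mulrNz -[LHS](periodicn fT n.+1) subrK.
Qed.

Lemma periodic_translate_itv (R : realType) (T t : R) : 0 < T ->
  exists m : int, t + T *~ m \in `[0, T].
Proof.
move=> T0; exists (- Num.floor (t / T)).
have /andP[h1 h2] := floor_itv (t / T).
rewrite mulrNz -mulrzl in_itv /= subr_ge0 -ler_pdivlMr // h1 /=.
move: h2; rewrite intrD ltr_pdivrMr // mulrDl mul1r => /ltW h2.
by rewrite lerBlDl.
Qed.

(** Periodicity reduces the bound to one period, which is compact. *)
Lemma CS1_bounded (R : realType) (g : R -> R) : CS1 g ->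
  exists M, forall t, `|g t| <= M.
Proof.
move=> [gc gp].
have T0 : 0 < (pi : R) *+ 2 by rewrite pmulrn_lgt0 ?pi_gt0.
have cn : {within `[0, pi *+ 2], continuous (fun t => `|g t|)}.
  apply: continuous_subspaceT => t.
  exact: (continuous_comp (gc t) (@norm_continuous _ _ _)).
have [c _ cmax] := EVT_max (ltW T0) cn.
exists `|g c| => t.
have [m tm] := periodic_translate_itv t T0.
by rewrite -(periodicz gp m t); exact: cmax.
Qed.

Lemma le_supnorm (R : realType) (g : R -> R) (t : R) : CS1 g ->
  `|g t| <= supnorm g.
Proof.
move=> /CS1_bounded[M gM]; apply: ub_le_sup; last by exists t.
by exists M => _ [s _ <-].
Qed.

Lemma supnorm_le (R : realType) (g : R -> R) (B : R) :
  (forall t, `|g t| <= B) -> supnorm g <= B.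
Proof.
move=> gB; apply: ge_sup; first by exists `|g 0|, 0.
by move=> _ [s _ <-].
Qed.

Lemma supnorm_ge0 (R : realType) (g : R -> R) : CS1 g -> 0 <= supnorm g.
Proof. by move=> gC; exact: le_trans (normr_ge0 (g 0)) (le_supnorm _ gC). Qed.

Lemma supnorm_gt0 (R : realType) (g : R -> R) : CS1 g -> g <> cst 0 ->
  0 < supnorm g.
Proof.
move=> gC gn0; rewrite lt_def supnorm_ge0 // andbT; apply/negP => /eqP g0.
apply: gn0; apply/funext => t; apply/eqP.
by rewrite -normr_le0 -g0 le_supnorm.
Qed.

Lemma CS1B (R : realType) (f g : R -> R) : CS1 f -> CS1 g -> CS1 (f \- g).
Proof.
move=> [fc fp] [gc gp]; split; last by move=> t /=; rewrite fp gp.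
by move=> t; apply: continuousB; [exact: fc|exact: gc].
Qed.

Lemma CS1_sum (R : realType) (I : Type) (r : seq I) (c : I -> R)
    (F : I -> R -> R) : (forall i, CS1 (F i)) ->
  CS1 (fun t => \sum_(i <- r) c i * F i t).
Proof.
move=> FC; elim: r => [|i r [IHc IHp]].
  rewrite (_ : (fun _ => _) = cst 0); last by apply/funext => t; rewrite big_nil.
  by split=> //; exact: cst_continuous.
rewrite (_ : (fun _ => _) = (fun t => c i * F i t) \+
    (fun t => \sum_(i <- r) c i * F i t)); last first.
  by apply/funext => t; rewrite big_cons.
have [Fc Fp] := FC i.
split; last by move=> t /=; rewrite Fp IHp.
move=> t; apply: continuousD; last exact: IHc.
exact: (@continuousM R R (cst (c i)) (F i) t (@cst_continuous _ _ _ t) (Fc t)).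
Qed.

Lemma CS1_Y (R : realType) (l k : nat) : CS1 (@Y R l k).
Proof.
have lin : continuous (fun t : R => l%:R * t).
  exact: (@mulrl_continuous R l%:R).
have per (h : R -> R) (t : R) : periodic h (pi *+ 2) ->
    h (l%:R * (t + pi *+ 2)) = h (l%:R * t).
  by move=> hp; rewrite mulrDr (mulr_natl (pi *+ 2)) (periodicn hp).
rewrite /Y; case: (l == 0%N); first by split=> //; exact: cst_continuous.
case: (k == 1%N); split=> t; rewrite ?per //; try exact: sinD2pi; try exact: cosD2pi.
- apply: (@continuousM R R (fun t => cos (l%:R * t)) (cst (Num.sqrt pi)^-1) t).
    exact: (continuous_comp (lin t) (@continuous_cos _ _)).
  exact: cst_continuous.
- apply: (@continuousM R R (fun t => sin (l%:R * t)) (cst (Num.sqrt pi)^-1) t).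
    exact: (continuous_comp (lin t) (@continuous_sin _ _)).
  exact: cst_continuous.
Qed.

(** * Exactness of the trapezoidal rule *)

Lemma equidistantE (R : realType) (N : nat) (x : nat -> R) (j : nat) :
  equidistant N x -> (j < N)%N ->
  exists m : int, x j.+1 = x 1%N + j%:R * (pi *+ 2 / N%:R) + (pi *+ 2) *~ m.
Proof.
move=> xE; elim: j => [|j IH] jN; first by exists 0; rewrite mul0r mulr0z !addr0.
have [|m' ->] := xE j.+1; first by rewrite jN.
have [m1 ->] := IH (ltnW jN).
exists (m1 + m'); rewrite mulrzDl -natr1; ring.
Qed.

(** Multiplying by 2 sin (a/2) makes the sum telescope, since
    2 sin (a/2) cos v = sin (v + a/2) - sin (v - a/2). *)
Lemma sum_cos_progression (R : realType) (a b : R) (n : nat) :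
  2 * sin (a / 2) * \sum_(0 <= j < n) cos (b + j%:R * a) =
  sin (b - a / 2 + n%:R * a) - sin (b - a / 2).
Proof.
elim: n => [|n IH]; first by rewrite big_nil mul0r addr0 mulr0 subrr.
rewrite big_nat_recr //= mulrDr IH.
set v := b + n%:R * a.
have -> : b - a / 2 + n%:R * a = v - a / 2 by rewrite /v; ring.
have -> : b - a / 2 + n.+1%:R * a = v + a / 2.
  by rewrite /v -natr1; field.
rewrite (sinD v (a / 2)) (sinB v (a / 2)); ring.
Qed.

(** The values m x_j form, modulo 2 pi, an arithmetic progression of step
    a = 2 pi m / N; after N terms it has advanced by a multiple of 2 pi, so that
    the telescoped sum vanishes, while sin (a/2) = sin (pi m / N) is not zero.
    The phase b makes this one statement cover sines as well as cosines. *)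
Lemma sum_nodes_cos (R : realType) (N : nat) (x : nat -> R) (m : nat) (b : R) :
  equidistant N x -> (0 < m < N)%N ->
  \sum_(1 <= j < N.+1) cos (m%:R * x j + b) = 0.
Proof.
move=> xE /andP[m0 mN].
have N0 : (N%:R : R) != 0 by rewrite pnatr_eq0 -lt0n (ltn_trans m0 mN).
pose a : R := m%:R * (pi *+ 2 / N%:R).
have -> : \sum_(1 <= j < N.+1) cos (m%:R * x j + b) =
    \sum_(0 <= j < N) cos (m%:R * x 1%N + b + j%:R * a).
  rewrite big_add1; apply: eq_big_nat => j /andP[_ jN].
  have [z ->] := equidistantE xE jN.
  rewrite -[RHS](periodicz (@cosD2pi R) (m%:Z * z)) /a.
  rewrite -!(mulrzr (pi *+ 2)) intrM -pmulrn; congr cos; ring.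
have s0 : sin (a / 2) != 0.
  rewrite gt_eqF // sin_gt0_pi //.
  have -> : a / 2 = pi * (m%:R / N%:R) by rewrite /a -mulr_natr; field.
  rewrite mulr_gt0 ?pi_gt0 ?divr_gt0 ?ltr0n ?(ltn_trans m0 mN) //=.
  by rewrite gtr_pMr ?pi_gt0 // ltr_pdivrMr ?ltr0n ?(ltn_trans m0 mN) // mul1r ltr_nat.
have := sum_cos_progression a (m%:R * x 1%N + b) N.
have -> : N%:R * a = pi *+ 2 *+ m by rewrite /a -[RHS]mulr_natl; field.
rewrite (periodicn (@sinD2pi R)) subrr => /eqP.
by rewrite !mulf_eq0 pnatr_eq0 (negbTE s0) /= => /eqP.
Qed.

(** * Discrete orthonormality *)

(** Listing the indices (l, k) in one sequence turns the double sums into sums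
    over a duplicate-free sequence, to which orthonormality and the
    Cauchy-Schwarz inequality apply directly. *)
Definition modes (M : nat) : seq (nat * nat) :=
  [seq (l, k) | l <- index_iota 0 M, k <- index_iota 1 (gam l).+2].

Lemma mem_modes (M l k : nat) :
  ((l, k) \in modes M) = (l < M)%N && (1 <= k <= (gam l).+1)%N.
Proof.
apply/allpairsPdep/andP => [[l' [k' []]]|[lM kl]].
  by rewrite !mem_index_iota => lM kl [-> ->].
by exists l, k; rewrite !mem_index_iota.
Qed.

Lemma modes_uniq (M : nat) : uniq (modes M).
Proof.
apply: (@allpairs_uniq_dep _ (fun=> nat)); first exact: iota_uniq.
- by move=> l _; exact: iota_uniq.
- by move=> [l k] [l' k'] _ _ /= [-> ->].
Qed.

Lemma sum_modes (R : realType) (M : nat) (F : nat -> nat -> R) :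
  \sum_(0 <= l < M) \sum_(1 <= k < (gam l).+2) F l k =
  \sum_(q <- modes M) F q.1 q.2.
Proof. by rewrite big_allpairs_dep. Qed.

(** A sine is a cosine with phase pi/2; this uniform expression spares the case
    distinction between cosines and sines in products of two modes. *)
Lemma Y_phase (R : realType) (l k : nat) (t : R) : (1 <= k <= (gam l).+1)%N ->
  Y l k t = (Num.sqrt (if l == 0%N then pi *+ 2 else pi))^-1 *
    cos (l%:R * t - (k == 2)%:R * (pi / 2)).
Proof.
case: l => [|l] /=.
  by case: k => [|[|k]] // _; rewrite /Y /= !mul0r subrr cos0 mulr1.
case: k => [|[|[|k]]] // _; rewrite /Y /= mulrC.
- by rewrite mul0r subr0.
- by rewrite mul1r cosBpihalf.
Qed.

Lemma innerNC (R : realType) (N : nat) (x : nat -> R) (f g : R -> R) :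
  innerN N x f g = innerN N x g f.
Proof. by rewrite /innerN; congr (_ * _); apply: eq_bigr => j _; rewrite mulrC. Qed.

(** The product of two cosines is half the sum of the cosines of the difference
    and of the sum of the arguments.  The frequencies l - l' and l + l' are at
    most 2 L < N, so each contributes 0 to the discrete inner product unless it
    vanishes; what remains when l = l' is the cosine of the phase difference. *)
Lemma innerN_YY (R : realType) (L N : nat) (x : nat -> R) (l k l' k' : nat) :
  (2 * L + 1 <= N)%N -> equidistant N x ->
  (l, k) \in modes L.+1 -> (l', k') \in modes L.+1 ->
  innerN N x (@Y R l k) (@Y R l' k') = ((l, k) == (l', k'))%:R.
Proof.
move=> LN xE.
(* The difference l - l' must not be truncated. *)
wlog ll : l k l' k' / (l' <= l)%N.
  move=> H p q; case/orP: (leq_total l' l) => ll; first exact: H.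
  by rewrite innerNC eq_sym; exact: H.
rewrite !mem_modes => /andP[lL kl] /andP[lL' kl'].
have N0 : (0 < N)%N by apply: leq_trans LN; rewrite addn1.
pose s (k : nat) : R := (k == 2)%:R * (pi / 2).
pose A (l : nat) : R := (Num.sqrt (if l == 0%N then pi *+ 2 else pi))^-1.
have prodE j : Y l k (x j) * Y l' k' (x j) = A l * A l' / 2 *
    (cos ((l - l')%:R * x j + (s k' - s k)) + cos ((l + l')%:R * x j - (s k + s k'))).
  rewrite !Y_phase // -/(s k) -/(s k') -/(A l) -/(A l') natrB // natrD.
  have -> : (l%:R - l'%:R) * x j + (s k' - s k) =
    (l%:R * x j - s k) - (l'%:R * x j - s k') by ring.
  have -> : (l%:R + l'%:R) * x j - (s k + s k') =
    (l%:R * x j - s k) + (l'%:R * x j - s k') by ring.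
  set u := _ - s k; set v := _ - s k'.
  by rewrite (cosB u v) (cosD u v); field.
rewrite /innerN (eq_bigr _ (fun j _ => prodE j)) -mulr_sumr big_split /=.
have pi0 : (pi : R) != 0 by rewrite gt_eqF ?pi_gt0.
have N0R : (N%:R : R) != 0 by rewrite pnatr_eq0 -lt0n.
have sum0 b : \sum_(1 <= j < N.+1) cos (0%:R * x j + b) = N%:R * cos b.
  rewrite (eq_bigr (fun=> cos b)); last by move=> j _; rewrite mul0r add0r.
  by rewrite big_const_nat iter_addr_0 subn1 /= mulr_natl.
case: (posnP l) => [l0|lp].
  move: ll kl kl'; rewrite l0 leqn0 => /eqP ->.
  case: k {prodE} => [|[|k]] //; case: k' => [|[|k']] // _ _.
  rewrite !sum0 /s /= mul0r subrr addr0 oppr0 cos0 /A /= -expr2 exprVn.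
  rewrite sqr_sqrtr; last by rewrite mulrn_wge0 ?pi_ge0.
  by move: (pi : R) pi0 => p p0; field; rewrite N0R p0.
have -> : \sum_(1 <= j < N.+1) cos ((l + l')%:R * x j - (s k + s k')) = 0.
  apply: sum_nodes_cos => //; rewrite addn_gt0 lp /=.
  rewrite ltnS in lL; rewrite ltnS in lL'.
  apply: leq_trans LN; rewrite addn1 ltnS mul2n -addnn; exact: leq_add.
case: (ltngtP l' l) ll => // [ll _|ll _].
  rewrite sum_nodes_cos // ?addr0 ?mulr0; last first.
    rewrite subn_gt0 ll /= (leq_ltn_trans (leq_subr _ _)) // (leq_trans lL) //.
    by apply: leq_trans LN; rewrite addn1 ltnS leq_pmull.
  by rewrite xpair_eqE (gtn_eqF ll).
subst l'; rewrite subnn sum0 addr0 xpair_eqE eqxx /= /A gtn_eqF //.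
have -> : cos (s k' - s k) = (k == k')%:R.
  have gl : gam l = 1%N by case: (l) lp.
  rewrite gl in kl; rewrite gl in kl'.
  rewrite /s; case: k kl {prodE} => [|[|[|k]]] // _;
    case: k' kl' => [|[|[|k']]] // _ /=.
  - by rewrite subrr cos0.
  - by rewrite mul0r subr0 mul1r cos_pihalf.
  - by rewrite mul0r sub0r mul1r cosN cos_pihalf.
  - by rewrite subrr cos0.
rewrite -expr2 exprVn sqr_sqrtr ?pi_ge0 //.
by move: (pi : R) pi0 => p p0; field; rewrite N0R p0.
Qed.

(** * The regularized operator *)

Lemma innerN_sum (R : realType) (N : nat) (x : nat -> R) (I : Type)
    (r : seq I) (c : I -> R) (F : I -> R -> R) (z : R -> R) :
  innerN N x (fun t => \sum_(i <- r) c i * F i t) z =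
  \sum_(i <- r) c i * innerN N x (F i) z.
Proof.
rewrite /innerN (eq_bigr _ (fun j _ => mulr_suml _ _ _ _)) exchange_big mulr_sumr.
apply: eq_bigr => i _; rewrite mulrCA; congr (_ * _); rewrite mulr_sumr.
by apply: eq_bigr => j _; rewrite mulrA.
Qed.

Lemma UopE (R : realType) (beta : nat -> nat -> R) (lambda : R) (L N : nat)
    (x : nat -> R) (g : R -> R) (t : R) :
  Uop beta lambda L N x g t = \sum_(q <- modes L.+1)
    innerN N x g (@Y R q.1 q.2) / (1 + lambda * beta q.1 q.2 ^+ 2) * Y q.1 q.2 t.
Proof.
exact: (@sum_modes R L.+1 (fun l k =>
  innerN N x g (@Y R l k) / (1 + lambda * beta l k ^+ 2) * Y l k t)).
Qed.

Lemma UopB (R : realType) (beta : nat -> nat -> R) (lambda : R) (L N : nat)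
    (x : nat -> R) (f g : R -> R) (t : R) :
  Uop beta lambda L N x (f \- g) t =
  Uop beta lambda L N x f t - Uop beta lambda L N x g t.
Proof.
rewrite !UopE -sumrB; apply: eq_bigr => q _.
rewrite -mulrBl -mulrBl; congr (_ / _ * _); rewrite /innerN -mulrBr -sumrB.
by congr (_ * _); apply: eq_bigr => j _; rewrite -mulrBl.
Qed.

Lemma Uop_sum (R : realType) (beta : nat -> nat -> R) (lambda : R) (L N : nat)
    (x : nat -> R) (I : Type) (r : seq I) (c : I -> R) (F : I -> R -> R) (t : R) :
  Uop beta lambda L N x (fun s => \sum_(i <- r) c i * F i s) t =
  \sum_(i <- r) c i * Uop beta lambda L N x (F i) t.
Proof.
rewrite UopE.
under eq_bigr => q _ do rewrite innerN_sum !mulr_suml.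
rewrite exchange_big; apply: eq_bigr => i _; rewrite UopE mulr_sumr.
by apply: eq_bigr => q _; rewrite !mulrA.
Qed.

(** By discrete orthonormality each mode is an eigenfunction. *)
Lemma Uop_Y (R : realType) (beta : nat -> nat -> R) (lambda : R) (L N : nat)
    (x : nat -> R) (q : nat * nat) (t : R) :
  (2 * L + 1 <= N)%N -> equidistant N x -> q \in modes L.+1 ->
  Uop beta lambda L N x (@Y R q.1 q.2) t =
  Y q.1 q.2 t / (1 + lambda * beta q.1 q.2 ^+ 2).
Proof.
move=> LN xE qM; rewrite UopE (bigD1_seq q) ?modes_uniq //=.
rewrite big_seq_cond big1 ?addr0 => [|[l k] /andP[pM pq]].
  by case: q qM => l k qM; rewrite (innerN_YY LN) // eqxx mul1r mulrC.
case: q qM pq => l' k' qM pq.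
by rewrite (innerN_YY LN) //= eq_sym (negbTE pq) !mul0r.
Qed.

Lemma CS1_Uop (R : realType) (beta : nat -> nat -> R) (lambda : R) (L N : nat)
    (x : nat -> R) (g : R -> R) : CS1 (Uop beta lambda L N x g).
Proof.
rewrite (funext (UopE beta lambda L N x g)).
by apply: (@CS1_sum R _ _ _ (fun q => @Y R q.1 q.2)) => q; exact: CS1_Y.
Qed.

(** On the right, the discrete inner product with the constant 1 is the quadrature
    of |z|. *)
Lemma normr_innerN_le (R : realType) (N : nat) (x : nat -> R) (g z : R -> R) :
  CS1 g -> `|innerN N x g z| <= supnorm g * innerN N x (cst 1) (fun t => `|z t|).
Proof.
move=> gC; have c0 : 0 <= pi *+ 2 / N%:R :> R.
  by rewrite divr_ge0 ?ler0n // mulrn_wge0 // pi_ge0.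
rewrite /innerN normrM (ger0_norm c0) mulrCA ler_wpM2l // mulr_sumr.
apply: le_trans (ler_norm_sum _ _ _) _; apply: ler_sum => j _.
by rewrite normrM /= mul1r ler_wpM2r // le_supnorm.
Qed.

(** An operator of finite rank given by point values is bounded.  Hence the set
    of quotients in the definition of the Lebesgue constant is bounded above and
    its real supremum dominates each of them. *)
Lemma Uop_bounded (R : realType) (beta : nat -> nat -> R) (lambda : R)
    (L N : nat) (x : nat -> R) : exists C : R, forall g, CS1 g ->
  supnorm (Uop beta lambda L N x g) <= C * supnorm g.
Proof.
exists (\sum_(q <- modes L.+1) innerN N x (cst 1) (fun t => `|@Y R q.1 q.2 t|) /
   `|1 + lambda * beta q.1 q.2 ^+ 2| * supnorm (@Y R q.1 q.2)) => g gC.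
apply: supnorm_le => t; rewrite UopE mulr_suml.
apply: le_trans (ler_norm_sum _ _ _) _; apply: ler_sum => q _.
rewrite 2!normrM normfV [leRHS]mulrAC; apply: ler_pM => //.
- by rewrite [leRHS]mulrAC ler_wpM2r ?invr_ge0 // mulrC normr_innerN_le.
- by apply: le_supnorm; exact: CS1_Y.
Qed.

(** * The Lebesgue constant *)

Lemma le_lebesgue_constant (R : realType) (T : (R -> R) -> R -> R) (C : R)
    (g : R -> R) : (forall h, CS1 h -> supnorm (T h) <= C * supnorm h) ->
  CS1 g -> g <> cst 0 -> supnorm (T g) / supnorm g <= lebesgue_constant T.
Proof.
move=> TC gC g0; apply: ub_le_sup; last by exists g.
exists C => _ [h [hC h0] <-].
by rewrite ler_pdivrMr ?supnorm_gt0 // TC.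
Qed.

Lemma normr_le_lebesgue (R : realType) (T : (R -> R) -> R -> R) (C : R)
    (g : R -> R) (t : R) : (forall h, CS1 h -> supnorm (T h) <= C * supnorm h) ->
  CS1 g -> CS1 (T g) -> `|T g t| <= lebesgue_constant T * supnorm g.
Proof.
move=> TC gC TgC; have [g0|g0] := pselect (g = cst 0); last first.
  apply: le_trans (le_supnorm t TgC) _.
  by rewrite -ler_pdivrMr ?supnorm_gt0 // (le_lebesgue_constant TC).
have sg : supnorm g = 0.
  apply/le_anti; rewrite supnorm_ge0 // andbT.
  by apply: supnorm_le => s; rewrite g0 normr0.
by apply: le_trans (le_supnorm t TgC) _; rewrite (le_trans (TC _ gC)) // sg !mulr0.
Qed.

(** As beta_{0,1} = 0, the constant function Y_{0,1} is fixed by the operator. *)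
Lemma lebesgue_Uop_ge1 (R : realType) (beta : nat -> nat -> R) (lambda : R)
    (L N : nat) (x : nat -> R) :
  (2 * L + 1 <= N)%N -> equidistant N x -> beta 0%N 1%N = 0 ->
  1 <= lebesgue_constant (Uop beta lambda L N x).
Proof.
move=> LN xE b0.
have [C UC] := Uop_bounded beta lambda L N x.
have Y0 : @Y R 0 1 <> cst 0.
  move/(congr1 (fun h => h 0)) => /eqP.
  by rewrite /Y /= invr_eq0 sqrtr_eq0 leNgt pmulrn_lgt0 // pi_gt0.
have UY : Uop beta lambda L N x (@Y R 0 1) = @Y R 0 1.
  apply/funext => t; rewrite (@Uop_Y _ _ _ _ _ _ (0, 1)%N) ?mem_modes //=.
  by rewrite b0 expr0n mulr0 addr0 divr1.
have := le_lebesgue_constant UC (CS1_Y R 0 1) Y0.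
by rewrite UY divff // gt_eqF // supnorm_gt0 //; exact: CS1_Y.
Qed.

(** * The bias of the filter on the de la Vallee-Poussin mean *)

(** Any positive upper bound K of the sum of the b_i^2 can replace that sum.
    With P the sum of the a_i b_i, expanding the square sum of K a_i - P b_i
    gives 0 <= K^2 A - 2 K P^2 + P^2 B <= K (K A - P^2). *)
Lemma CauchySchwarz_seq (R : realFieldType) (I : Type) (r : seq I)
    (a b : I -> R) (K : R) : 0 < K -> \sum_(i <- r) b i ^+ 2 <= K ->
  (\sum_(i <- r) a i * b i) ^+ 2 <= K * \sum_(i <- r) a i ^+ 2.
Proof.
move=> K0 bK; have expand p : \sum_(i <- r) (K * a i - p * b i) ^+ 2 =
    K ^+ 2 * (\sum_(i <- r) a i ^+ 2) - 2 * K * p * (\sum_(i <- r) a i * b i)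
    + p ^+ 2 * \sum_(i <- r) b i ^+ 2.
  by rewrite !mulr_sumr -sumrB -big_split; apply: eq_bigr => i _ /=; ring.
set P := \sum_(i <- r) a i * b i in expand *.
have : 0 <= \sum_(i <- r) (K * a i - P * b i) ^+ 2.
  by apply: sumr_ge0 => i _; exact: sqr_ge0.
have := ler_wpM2l (sqr_ge0 P) bK; rewrite expand => PB sq_ge0.
by rewrite -(ler_pM2l K0); nra.
Qed.

(** Each frequency l > 0 contributes (cos^2 + sin^2) / pi = 1 / pi, and the
    constant mode contributes half of it. *)
Lemma sum_Y_sqr (R : realType) (M : nat) (t : R) :
  \sum_(q <- modes M.+1) Y q.1 q.2 t ^+ 2 = (M%:R + 2^-1) / pi.
Proof.
rewrite -(sum_modes _ (fun l k => Y l k t ^+ 2)) big_nat_recl //= big_nat1.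
have -> : Y 0 1 t ^+ 2 = 2^-1 / pi.
  rewrite /Y /= exprVn sqr_sqrtr; last by rewrite mulrn_wge0 ?pi_ge0.
  by rewrite -[pi *+ 2]mulr_natl invfM.
rewrite (eq_bigr (fun=> pi^-1)) => [|l _].
  by rewrite big_const_nat iter_addr_0 subn0 mulrDl mulr_natl addrC.
rewrite big_nat_recl // big_nat1 /Y /= !expr_div_n sqr_sqrtr ?pi_ge0 //.
by rewrite -mulrDl cos2Dsin2 mul1r.
Qed.

Lemma Wterm_ge0 (R : realType) (phi : R -> R) (beta : nat -> nat -> R)
  (f : R -> R) (l : nat) : 0 <= Wterm phi beta f l.
Proof. by apply: sumr_ge0 => k _; rewrite divr_ge0 ?sqr_ge0. Qed.

(** The series of the squared norm has nonnegative terms, hence dominates its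
    partial sums. *)
Lemma sum_modes_le_Wnorm (R : realType) (beta : nat -> nat -> R) (f : R -> R)
    (M : nat) : inW (@phi_half R) beta f ->
  \sum_(q <- modes M) beta q.1 q.2 ^+ 2 * innerL2 f (@Y R q.1 q.2) ^+ 2
    <= Wnorm (@phi_half R) beta f ^+ 2.
Proof.
move=> fW; rewrite -(sum_modes _ (fun l k => beta l k ^+ 2 * innerL2 f (@Y R l k) ^+ 2)).
have -> : \sum_(0 <= l < M) \sum_(1 <= k < (gam l).+2)
    beta l k ^+ 2 * innerL2 f (@Y R l k) ^+ 2 = series (Wterm (@phi_half R) beta f) M.
  apply: eq_bigr => l _; rewrite Wterm_phi_half; apply: eq_bigr => k _.
  by rewrite real_normK ?num_real.
have hM := nondecreasing_cvgn_le
  (nondecreasing_series (fun n _ _ => Wterm_ge0 (@phi_half R) beta f n)) fW.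
rewrite sqr_sqrtr; first exact: hM.
by apply: le_trans (hM 0%N); rewrite big_nil.
Qed.

Lemma hVP_itv (R : realType) (n l : nat) : (0 < n)%N -> (l < n.*2)%N ->
  0 <= hVP R n l <= 1.
Proof.
move=> n0 ln; rewrite /hVP; case: (leqP l n) => [_|nl]; first by rewrite ler01 lexx.
rewrite -natrB ?(ltnW nl) // subr_ge0 gerBl divr_ge0 ?ler0n // andbT.
by rewrite ler_pdivrMr ?ltr0n // mul1r ler_nat leq_subLR addnn ltnW.
Qed.

(** The bias is a^2 / (1 + a^2), and a <= 1 + a^2.  Keeping only the first power
    of a is what brings in beta and not beta^2, that is, the norm of the space
    with index function t^(1/2). *)
Lemma filter_bias_le (R : realFieldType) (a : R) : 0 <= a ->
  0 <= 1 - (1 + a ^+ 2)^-1 <= a.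
Proof.
move=> a0; have d0 : 0 < 1 + a ^+ 2 by rewrite ltr_pwDl // sqr_ge0.
have -> : 1 - (1 + a ^+ 2)^-1 = a ^+ 2 / (1 + a ^+ 2).
  by field; rewrite gt_eqF.
rewrite divr_ge0 ?sqr_ge0 ?(ltW d0) //= ler_pdivrMr //; nra.
Qed.

Definition VPcoef (R : realType) (n : nat) (f : R -> R) (q : nat * nat) : R :=
  hVP R n q.1 * innerL2 f (@Y R q.1 q.2).

Lemma VPE (R : realType) (n : nat) (f : R -> R) :
  VP n f = fun t => \sum_(q <- modes n.*2) VPcoef n f q * Y q.1 q.2 t.
Proof.
apply/funext => t.
exact: (@sum_modes R n.*2 (fun l k => hVP R n l * innerL2 f (@Y R l k) * Y l k t)).
Qed.

Lemma CS1_VP (R : realType) (n : nat) (f : R -> R) : CS1 (VP n f).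
Proof.
by rewrite VPE; apply: (@CS1_sum R _ _ _ (fun q => @Y R q.1 q.2)) => q; exact: CS1_Y.
Qed.

(** The mean only contains frequencies below 2 n <= L, all of which are
    eigenfunctions of the operator. *)
Lemma VP_sub_Uop_VP (R : realType) (beta : nat -> nat -> R) (lambda : R)
    (L N n : nat) (x : nat -> R) (f : R -> R) (t : R) :
  (2 * L + 1 <= N)%N -> (n.*2 <= L)%N -> equidistant N x ->
  VP n f t - Uop beta lambda L N x (VP n f) t = \sum_(q <- modes n.*2)
    (1 - (1 + lambda * beta q.1 q.2 ^+ 2)^-1) * VPcoef n f q * Y q.1 q.2 t.
Proof.
move=> LN nL xE; rewrite VPE (Uop_sum _ _ _ _ _ _ _ (fun q => @Y R q.1 q.2)) -sumrB.
apply: eq_big_seq => -[l k] qn; rewrite (Uop_Y _ _ _ LN) //; first by rewrite /=; ring.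
move: qn; rewrite !mem_modes => /andP[ln ->]; rewrite andbT.
by rewrite ltnS ltnW // (leq_trans ln).
Qed.

(** Cauchy-Schwarz, applied to the products of sqrt lambda * beta |c| and |Y|. *)
Lemma Uop_VP_bias (R : realType) (beta : nat -> nat -> R) (lambda : R)
    (L N n : nat) (x : nat -> R) (f : R -> R) (t : R) :
  (0 < n)%N -> (n.*2 <= L)%N -> (2 * L + 1 <= N)%N -> 0 < lambda ->
  admissible_beta beta -> equidistant N x -> inW (@phi_half R) beta f ->
  `|Uop beta lambda L N x (VP n f) t - VP n f t|
    <= Num.sqrt (lambda * L%:R) * Wnorm (@phi_half R) beta f.
Proof.
move=> n0 nL LN lam0 [bge0 _] xE fW.
have L0 : (0 < L)%N by apply: leq_trans nL; rewrite double_gt0.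
rewrite distrC VP_sub_Uop_VP //.
pose a (q : nat * nat) := Num.sqrt lambda * (beta q.1 q.2 * `|innerL2 f (@Y R q.1 q.2)|).
pose b (q : nat * nat) := `|Y q.1 q.2 t|.
have step1 : `|\sum_(q <- modes n.*2)
    (1 - (1 + lambda * beta q.1 q.2 ^+ 2)^-1) * VPcoef n f q * Y q.1 q.2 t|
    <= \sum_(q <- modes n.*2) a q * b q.
  apply: le_trans (ler_norm_sum _ _ _) _; rewrite big_seq [leRHS]big_seq.
  apply: ler_sum => -[l k]; rewrite mem_modes => /andP[ln kl] /=.
  rewrite normrM ler_wpM2r // /a /= [leRHS]mulrA normrM.
  have sb0 : 0 <= Num.sqrt lambda * beta l k.
    by rewrite mulr_ge0 ?sqrtr_ge0 ?bge0.
  have := filter_bias_le sb0; rewrite exprMn sqr_sqrtr ?(ltW lam0) // => /andP[w0 w1].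
  have /andP[h0 h1] := @hVP_itv R n l n0 ln.
  rewrite ler_pM // ?(ger0_norm w0) //.
  by rewrite /VPcoef /= normrM (ger0_norm h0) ler_piMl.
have bK : \sum_(q <- modes n.*2) b q ^+ 2 <= L%:R.
  under eq_bigr => q _ do rewrite real_normK ?num_real //.
  rewrite -(@prednK n.*2) ?double_gt0 // sum_Y_sqr.
  rewrite ler_pdivrMr ?pi_gt0 //.
  (* At most L - 1 nonzero frequencies occur, and 1 / pi <= 1 / 2. *)
  have p2 := pi_ge2 R.
  have : (n.*2.-1%:R + 1 : R) <= L%:R by rewrite natr1 ler_nat prednK ?double_gt0.
  have : (0 : R) < L%:R by rewrite ltr0n.
  nra.
have aW : \sum_(q <- modes n.*2) a q ^+ 2 <=
    lambda * Wnorm (@phi_half R) beta f ^+ 2.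
  rewrite (eq_bigr (fun q => lambda *
    (beta q.1 q.2 ^+ 2 * innerL2 f (@Y R q.1 q.2) ^+ 2))); last first.
    by move=> q _; rewrite !exprMn sqr_sqrtr ?(ltW lam0) // real_normK ?num_real.
  by rewrite -mulr_sumr ler_wpM2l ?(ltW lam0) // sum_modes_le_Wnorm.
have L0R : (0 : R) < L%:R by rewrite ltr0n.
apply: le_trans step1 _.
have W0 : 0 <= Wnorm (@phi_half R) beta f by exact: sqrtr_ge0.
rewrite -ler_sqr ?nnegrE; last 2 first.
- rewrite big_seq; apply: sumr_ge0 => -[l k]; rewrite mem_modes => /andP[_ kl].
  by rewrite /a /b !mulr_ge0 ?sqrtr_ge0 ?bge0.
- by rewrite mulr_ge0 ?sqrtr_ge0.
apply: le_trans (CauchySchwarz_seq _ L0R bK) _.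
rewrite exprMn sqr_sqrtr ?mulr_ge0 ?(ltW lam0) ?(ltW L0R) // (mulrC lambda) -mulrA.
by rewrite ler_wpM2l // ltW.
Qed.

Theorem theorem4p3 (R : realType) :
  exists2 c : R, 0 < c &
  forall (L N : nat) (lambda : R) (beta : nat -> nat -> R) (x : nat -> R)
    (f feps eps : R -> R),
  (2 <= L)%N -> (2 * L + 1 <= N)%N -> 0 < lambda ->
  admissible_beta beta -> beta 0%N 1%N = 0 ->
  equidistant N x ->
  CS1 f -> CS1 feps -> CS1 eps ->
  supnorm (f \- feps) = supnorm eps ->
  inW (@phi_half R) beta f ->
  supnorm (VP L./2 f \- f) <= supnorm eps ->
  supnorm (Uop beta lambda L N x feps \- f)
    <= c * supnorm eps * lebesgue_constant (Uop beta lambda L N x)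
       + Num.sqrt (lambda * L%:R) * Wnorm (@phi_half R) beta f.
Proof.
exists 3 => // L N lambda beta x f feps eps L2 LN lam0 bA b0 xE fC feC eC fe fW fVP.
set n := L./2; set Lam := lebesgue_constant _.
have n0 : (0 < n)%N by rewrite /n half_gt0.
have nL : (n.*2 <= L)%N by rewrite /n -{2}(odd_double_half L) leq_addl.
have VC : CS1 (VP n f) by exact: CS1_VP.
have [C UC] := Uop_bounded beta lambda L N x.
have UL g t : CS1 g -> `|Uop beta lambda L N x g t| <= Lam * supnorm g.
  by move=> gC; apply: normr_le_lebesgue UC _ _ => //; exact: CS1_Uop.
have Lam1 : 1 <= Lam by exact: lebesgue_Uop_ge1.
have e0 := supnorm_ge0 eC.
apply: supnorm_le => t.
have h1 := UL _ t (CS1B fC feC).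
have h2 := UL _ t (CS1B VC fC).
have h3 := Uop_VP_bias t n0 nL LN lam0 bA xE fW.
have h4 := le_supnorm t (CS1B VC fC).
rewrite fe in h1; rewrite !UopB /= in h1 h2; rewrite /= in h4 *.
have {}h2 := le_trans h2 (ler_wpM2l (le_trans ler01 Lam1) fVP).
have {}h4 := le_trans h4 (le_trans fVP (ler_peMl e0 Lam1)).
set u := Uop _ _ _ _ _ feps t in h1 *; set v := Uop _ _ _ _ _ f t in h1 h2.
set w := Uop _ _ _ _ _ _ t in h2 h3.
have -> : u - f t = (w - VP n f t) + (VP n f t - f t) - (w - v) - (v - u) by ring.
apply: le_trans (ler_normB _ _) _.
apply: le_trans (lerD (ler_normB _ _) (lexx _)) _.
apply: le_trans (lerD (lerD (ler_normD _ _) (lexx _)) (lexx _)) _.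
lra.
Qed.
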